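(* There are absolute constants $p_0,\epsilon_0\in(0,1)$ such that for any $p\le p_0$ and $\epsilon\le\epsilon_0$, finding a $(1+\epsilon)$-approximate minimum vertex cover of a bipartite stochastic graph $G_p$ requires querying a subgraph of maximum degree $\Omega\!\left(\frac{1}{\epsilon p}\right)$.
   Context: $G_p$ is the random subgraph of a given graph $G$ containing each edge independently with probability $p$. An algorithm non-adaptively chooses a subgraph $Q$ of $G$ to query, learns which edges of $Q$ are in $G_p$, and outputs a set $C$ of vertices that is a vertex cover of $G_p$ with probability $1$; it is $(1+\epsilon)$-approximate if $\mathbb{E}|C|\le(1+\epsilon)\mathbb{E}[\nu(G_p)]$, where $\nu$ denotes minimum vertex cover size. The statement asserts that there exist bipartite graphs $G$ for which every such algorithm must query a subgraph $Q$ of maximum degree $\Omega(1/(\epsilon p))$. *)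

(* Defs.v *)
From HB Require Import structures.
From mathcomp Require Import all_boot all_order all_algebra.
From mathcomp Require Import reals.

Set Implicit Arguments.
Unset Strict Implicit.
Unset Printing Implicit Defensive.

Import Order.TTheory GRing.Theory Num.Theory.
Local Open Scope ring_scope.

Record sgraph := SGraph {
  vertex :> finType;
  adj : rel vertex;
  adj_sym : symmetric adj;
  adj_irr : irreflexive adj }.

(* Subgraphs of [G] have the vertex set of [G]; they are given by their sets
   of edges, an edge being an unordered pair [set x; y] of vertices. *)
Definition edges (G : sgraph) : {set {set G}} :=
  [set f : {set G} | [exists x, exists y, adj x y && (f == [set x; y])]].

Definition bipartite (G : sgraph) : Prop :=
  exists S : {set G}, forall x y : G, adj x y -> (x \in S) != (y \in S).

Definition degree (V : finType) (Q : {set {set V}}) (v : V) : nat :=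
  #|[set f in Q | v \in f]|.

Definition max_degree (V : finType) (Q : {set {set V}}) : nat :=
  \max_(v : V) degree Q v.

Definition vertex_cover (V : finType) (H : {set {set V}}) (C : {set V}) : bool :=
  [forall f in H, [exists v in C, v \in f]].

(* [arg min_ ...] is a minimum as soon as its default [set: V] is a cover,
   which holds when every member of [H] is nonempty, see [vertex_coverT]. *)
Definition nu (V : finType) (H : {set {set V}}) : nat :=
  #|[arg min_(C < [set: V] | vertex_cover H C) #|C|]|.

Lemma vertex_coverT (G : sgraph) (H : {set {set G}}) :
  H \subset edges G -> vertex_cover H [set: G].
Proof.
move=> /subsetP sHE; apply/forall_inP => f /sHE.
rewrite inE => /existsP[x /existsP[y /andP[_ /eqP->]]].
by apply/exists_inP; exists x; rewrite !inE ?eqxx.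
Qed.

(* Probability that the set of realized edges of G_p is exactly [H]. *)
Definition Gp_prob (R : realType) (G : sgraph) (p : R) (H : {set {set G}}) : R :=
  \prod_(f in edges G) (if f \in H then p else 1 - p).

Definition Gp_expect (R : realType) (G : sgraph) (p : R)
    (X : {set {set G}} -> R) : R :=
  \sum_(H in powerset (edges G)) Gp_prob p H * X H.

(* Algorithms may be randomized: a seed [w] is drawn with probability
   [weight w], independently of G_p. Since a fixed [G] admits only finitely
   many pairs (query set, output function), a finite seed space is fully
   general. The queries depend only on the seed (non-adaptivity), and
   [output w] is applied to the set of queried edges that are realized. *)
Record algorithm (R : realType) (G : sgraph) := Algorithm {
  seed : finType;
  weight : seed -> R;
  weight_ge0 : forall w, 0 <= weight w;
  weight_sum1 : \sum_w weight w = 1;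
  query : seed -> {set {set G}};
  query_sub : forall w, query w \subset edges G;
  output : seed -> {set {set G}} -> {set G} }.

Definition result (R : realType) (G : sgraph) (A : algorithm R G)
    (w : seed A) (H : {set {set G}}) : {set G} :=
  output w (query w :&: H).

Definition alg_expect (R : realType) (G : sgraph) (p : R) (A : algorithm R G)
    (X : seed A -> {set {set G}} -> R) : R :=
  \sum_(w : seed A) weight w * Gp_expect p (X w).

Definition covers_with_prob1 (R : realType) (G : sgraph) (p : R)
    (A : algorithm R G) : Prop :=
  alg_expect p (fun (w : seed A) H => (vertex_cover H (result w H))%:R) = 1.

Definition approximates (R : realType) (G : sgraph) (p eps : R)
    (A : algorithm R G) : Prop :=
  alg_expect p (fun (w : seed A) H => #|result w H|%:R)
    <= (1 + eps) * Gp_expect p (fun H : {set {set G}} => (nu H)%:R).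

(* Main.v *)
(* Take the complete bipartite graph on A and B with |A| = m ~ 1/(2p) and
   |B| = n ~ 1/(128 eps p), and hang k pendant edges on every vertex of B, so
   that a vertex of B is bare (none of its pendant edges is realized) with
   probability q = (1-p)^k between 16 eps and 32 eps. Covering G_p by the
   non-bare vertices of B and one endpoint for each realized edge between A and
   the bare vertices costs at most n(1-q) + mnpq in expectation, and mp is about
   1/2. The output of the algorithm has to cover every unqueried edge. If the
   queries have degree at most c/(eps p), a small fraction of n, nearly all edges
   between A and the bare vertices are unqueried; since about nq < m vertices are
   bare, covering these edges costs almost nq on top of the n(1-q) vertices
   spent on the pendant edges. The difference is a constant multiple of nq, which
   exceeds the allowed excess eps E[nu(G_p)] <= eps n. *)
Require Import Defs.
From HB Require Import structures.
From mathcomp Require Import all_boot all_order all_algebra.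
From mathcomp Require Import reals.
From mathcomp Require Import lra ring.

Set Implicit Arguments.
Unset Strict Implicit.
Unset Printing Implicit Defensive.

Import Order.TTheory GRing.Theory Num.Theory.
Local Open Scope ring_scope.

(** * Expectation over the random subgraph, and covers that never fail *)

Section Expectation.
Variables (R : realType) (G : sgraph) (p : R).
Implicit Types (H S T : {set {set G}}) (X Y : {set {set G}} -> R).

Lemma eq_Gp_expect X Y :
  (forall H, X H = Y H) -> Gp_expect p X = Gp_expect p Y.
Proof. by move=> XY; apply: eq_bigr => H _; rewrite XY. Qed.

Lemma Gp_expectD X Y :
  Gp_expect p (fun H => X H + Y H) = Gp_expect p X + Gp_expect p Y.
Proof. by rewrite -big_split; apply: eq_bigr => H _; rewrite mulrDr. Qed.

Lemma Gp_expectZ (a : R) X :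
  Gp_expect p (fun H => a * X H) = a * Gp_expect p X.
Proof. by rewrite [RHS]mulr_sumr; apply: eq_bigr => H _; rewrite mulrCA. Qed.

Lemma Gp_expect_sum (I : finType) (X : I -> {set {set G}} -> R) :
  Gp_expect p (fun H => \sum_i X i H) = \sum_i Gp_expect p (X i).
Proof.
by rewrite exchange_big; apply: eq_bigr => H _; rewrite mulr_sumr.
Qed.

(** Independence of the edges: the expectation of a product of one factor per edge is the product of
    the expectations. *)
Lemma Gp_expect_prod (F1 F0 : {set G} -> R) :
  Gp_expect p (fun H => \prod_(f in edges G) (if f \in H then F1 f else F0 f))
  = \prod_(f in edges G) (p * F1 f + (1 - p) * F0 f).
Proof.
rewrite [RHS]big_mkcond /=.
(* Off the edges the summands are 0 and 1, so distributing the product over the sums kills every [H]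
   not contained in [edges G]. *)
rewrite [RHS](eq_bigr (fun f => (if f \in edges G then p * F1 f else 0)
   + (if f \in edges G then (1 - p) * F0 f else 1))); last first.
  by move=> f _; case: ifP => // _; rewrite add0r.
rewrite bigA_distr /Gp_expect big_mkcond [RHS]big_mkcond /=.
apply: eq_bigr => H _; rewrite !inE; case: ifP => [/subsetP sHE|/negbT sHE].
  rewrite /Gp_prob -big_split big_mkcond /=.
  apply: eq_bigr => f _; have := sHE f.
  by case: (f \in H); case: (f \in edges G) => // /(_ isT).
have /subsetPn[f fH fE] := sHE.
by rewrite (bigD1 f) //= fH (negPf fE) mul0r.
Qed.

Lemma Gp_expect_incl_excl S T :
  S \subset edges G -> T \subset edges G -> [disjoint S & T] ->
  Gp_expect p (fun H => ((S \subset H) && [disjoint T & H])%:R)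
  = p ^+ #|S| * (1 - p) ^+ #|T|.
Proof.
move=> sSE sTE dST.
transitivity (Gp_expect p (fun H => \prod_(f in edges G)
    (if f \in H then (f \notin T)%:R else (f \notin S)%:R))).
  apply: eq_Gp_expect => H; case: (boolP (_ && _)) => [/andP[sSH dTH]|].
    rewrite big1 // => f _; case: ifPn => fH.
      by rewrite (disjointFl dTH fH).
    by rewrite (contra (subsetP sSH f) fH).
  rewrite negb_and => /orP[/subsetPn[f fS fH]|].
    rewrite (bigD1 f) /=; last exact: (subsetP sSE).
    by rewrite (negPf fH) fS mul0r.
  rewrite -setI_eq0 => /set0Pn[f /setIP[fT fH]].
  rewrite (bigD1 f) /=; last exact: (subsetP sTE).
  by rewrite fH fT mul0r.
rewrite Gp_expect_prod.
rewrite (eq_bigr (fun f => (if f \in S then p else 1)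
                         * (if f \in T then 1 - p else 1))); last first.
  move=> f _; case: ifP => fS /=; first rewrite (disjointFr dST fS) /=.
    by ring.
  by case: ifP => _ /=; ring.
rewrite big_split /= -!big_mkcondr /= -!prodr_const; congr (_ * _).
  by apply: eq_bigl => f; apply: andb_idl; apply: (subsetP sSE).
by apply: eq_bigl => f; apply: andb_idl; apply: (subsetP sTE).
Qed.

Lemma Gp_expect_cst (a : R) : Gp_expect p (fun _ : {set {set G}} => a) = a.
Proof.
transitivity (a * Gp_expect p (fun H : {set {set G}} =>
    ((set0 \subset H) && [disjoint set0 & H])%:R)); last first.
  by rewrite Gp_expect_incl_excl ?sub0set ?cards0 ?mulr1 // -setI_eq0 set0I.
rewrite -Gp_expectZ; apply: eq_Gp_expect => H.
by rewrite sub0set -setI_eq0 set0I eqxx mulr1.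
Qed.

Hypothesis p01 : 0 < p < 1.

Lemma Gp_prob_gt0 H : 0 < Gp_prob p H.
Proof.
by apply: prodr_gt0 => f _; case: ifP => _; case/andP: p01; lra.
Qed.

Lemma ler_Gp_expect X Y :
  (forall H, H \subset edges G -> X H <= Y H) ->
  Gp_expect p X <= Gp_expect p Y.
Proof.
move=> XY; apply: ler_sum => H; rewrite powersetE => /XY le_XY.
by rewrite ler_wpM2l // ltW // Gp_prob_gt0.
Qed.

(** Since [0 < p < 1], every edge set has positive probability, so a single failure under a seed of
    positive weight would already push the success probability below 1. *)
Lemma covers_with_prob1P (A : algorithm R G) (w : seed A) H :
  covers_with_prob1 p A -> 0 < weight w -> H \subset edges G ->
  vertex_cover H (result w H).
Proof.
move=> covA w_gt0 sHE; apply: contraT => ncov.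
pose fail (v : seed A) H' : R := (~~ vertex_cover H' (result v H'))%:R.
have fail_ge0 (v : seed A) : 0 <= weight v * Gp_expect p (fail v).
  rewrite mulr_ge0 ?weight_ge0 // sumr_ge0 // => H' _.
  by rewrite mulr_ge0 ?ler0n // ltW // Gp_prob_gt0.
have : \sum_(v : seed A) weight v * Gp_expect p (fail v) = 0.
  transitivity (\sum_(v : seed A) weight v - alg_expect p
      (fun (v : seed A) H' => (vertex_cover H' (result v H'))%:R : R)).
    rewrite /alg_expect -sumrB; apply: eq_bigr => v _.
    rewrite -[X in _ = X - _]mulr1 -mulrBr; congr (_ * _); apply/eqP.
    rewrite -subr_eq0 opprB addrA subr_eq0 -Gp_expectD; apply/eqP.
    rewrite -[RHS](Gp_expect_cst 1); apply: eq_Gp_expect => H'.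
    by rewrite /fail; case: vertex_cover; rewrite ?addr0 ?add0r.
  by rewrite covA weight_sum1 subrr.
move=> /(psumr_eq0P (fun v _ => fail_ge0 v))/(_ w isT)/eqP.
rewrite mulf_eq0 (gt_eqF w_gt0) /= => /eqP/psumr_eq0P/(_ H).
rewrite powersetE sHE /fail ncov mulr1 => /(_ _ isT) H0.
suff : Gp_prob p H = 0 by move=> P0; have := Gp_prob_gt0 H; rewrite P0 ltxx.
by apply: H0 => H' _; rewrite mulr_ge0 ?ler0n // ltW // Gp_prob_gt0.
Qed.

(* The unqueried edges might all be realized without changing the output. *)
Lemma result_covers_unqueried (A : algorithm R G) (w : seed A) H :
  covers_with_prob1 p A -> 0 < weight w -> H \subset edges G ->
  vertex_cover (H :|: (edges G :\: query w)) (result w H).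
Proof.
move=> covA w_gt0 sHE.
have <- : result w (H :|: (edges G :\: query w)) = result w H.
  by rewrite /result setIUr setIDA setIC setDIl setDv set0I setU0.
by apply: covers_with_prob1P => //; rewrite subUset sHE subsetDl.
Qed.

End Expectation.

Lemma nu_le (V : finType) (H : {set {set V}}) (C : {set V}) :
  vertex_cover H C -> (nu H <= #|C|)%N.
Proof.
move=> covC; rewrite /nu; case: arg_minnP => [|D _]; last exact.
apply/forall_inP => f fH; have /forall_inP/(_ f fH)/exists_inP[v _ vf] := covC.
by apply/exists_inP; exists v.
Qed.

(** The side condition excludes the swapped matching; it is applied to edges whose second endpoint
    lies in B and whose first does not. *)
Lemma set2_inj (T : finType) (a b a' b' : T) :
  [set a; b] = [set a'; b'] -> a != b' -> a = a' /\ b = b'.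
Proof.
move=> eqs nab'; have /set2P[eqa|/eqP] : a \in [set a'; b'].
- by rewrite -eqs set21.
- split=> //; have /set2P[eqb|//] : b \in [set a'; b'] by rewrite -eqs set22.
  have /set2P[eqb'|->//] : b' \in [set a; b] by rewrite eqs set22.
  by rewrite eqb' eqxx in nab'.
- by rewrite (negPf nab').
Qed.

(** * The hard bipartite graph and the combinatorics of its covers *)

Section Gadget.
Variables m n k : nat.

(** The summands are A, B and the pendant leaves, [(b, j)] being a leaf hanging on [b]. *)
Definition gvertex : Type := ('I_m + 'I_n) + 'I_n * 'I_k.

Definition gside (v : gvertex) : bool :=
  if v is inl (inr _) then true else false.

Definition garc (u v : gvertex) : bool :=
  match u, v with
  | inl (inl _), inl (inr _) => true
  | inr (b, _), inl (inr b') => b == b'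
  | _, _ => false
  end.

Definition gadj : rel gvertex := fun u v => garc u v || garc v u.

Lemma gadj_sym : symmetric gadj. Proof. by move=> u v; rewrite /gadj orbC. Qed.

Lemma gadj_irr : irreflexive gadj.
Proof. by case=> [[a|b]|[b j]]. Qed.

(* The complete bipartite graph on parts A and B of sizes [m] and [n], with [k]
   pendant edges attached to every vertex of B. *)
Definition gadget : sgraph := SGraph gadj_sym gadj_irr.

Lemma gadget_bipartite : bipartite gadget.
Proof.
exists [set v : gadget | gside v] => u v; rewrite !inE /= /gadj.
by case: u v => [[a|b]|[b j]] [[a'|b']|[b' j']].
Qed.

Definition va (a : 'I_m) : gadget := inl (inl a).
Definition vb (b : 'I_n) : gadget := inl (inr b).
Definition vl (b : 'I_n) (j : 'I_k) : gadget := inr (b, j).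
Definition eab (a : 'I_m) (b : 'I_n) : {set gadget} := [set va a; vb b].
Definition pend (b : 'I_n) : {set {set gadget}} :=
  [set [set vl b j; vb b] | j : 'I_k].

Implicit Types (H Q : {set {set gadget}}) (C : {set gadget}).

Lemma eab_edge a b : eab a b \in edges gadget.
Proof.
rewrite inE; apply/existsP; exists (va a); apply/existsP; exists (vb b).
by rewrite eqxx.
Qed.

Lemma pend_sub b : pend b \subset edges gadget.
Proof.
apply/subsetP => f /imsetP[j _ ->]; rewrite inE; apply/existsP; exists (vl b j).
by apply/existsP; exists (vb b); rewrite eqxx andbT /= /gadj /= eqxx.
Qed.

Lemma gadget_edgeP f : f \in edges gadget ->
  (exists a b, f = eab a b) \/ (exists b, f \in pend b).
Proof.
have arcP (u v : gadget) : garc u v ->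
    (exists a b, [set u; v] = eab a b) \/ (exists b, [set u; v] \in pend b).
  case: u v => [[a|b]|[b j]] [[a'|b']|[b' j']] //=; first by left; exists a, b'.
  by move=> /eqP->; right; exists b'; apply/imsetP; exists j.
rewrite inE => /existsP[u /existsP[v /andP[uv /eqP->]]].
by case/orP: uv => /arcP //; rewrite setUC.
Qed.

Lemma eab_inj a b a' b' : eab a b = eab a' b' -> a = a' /\ b = b'.
Proof. by case/set2_inj=> // [[->]] [->]. Qed.

Lemma eab_notin_pend a b b' : eab a b \notin pend b'.
Proof. by apply/imsetP => -[j _ /set2_inj[]]. Qed.

Lemma card_pend b : #|pend b| = k.
Proof.
by rewrite card_imset ?card_ord // => j j' /set2_inj[] // [->].
Qed.

Lemma pend_disjoint b b' : b != b' -> [disjoint pend b & pend b'].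
Proof.
move=> nbb'; rewrite -setI_eq0; apply/eqP/setP => f; rewrite in_set0.
apply/negP => /setIP[/imsetP[j _ ->] /imsetP[j' _ /set2_inj[] // [eqb]]].
by rewrite eqb eqxx in nbb'.
Qed.

Definition bare H b := [disjoint pend b & H].

Definition canonical_cover H : {set gadget} :=
  [set vb b | b in [pred b | ~~ bare H b]]
  :|: [set va a | a in [pred a | [exists b, bare H b && (eab a b \in H)]]].

Lemma canonical_coverP H :
  H \subset edges gadget -> vertex_cover H (canonical_cover H).
Proof.
move=> /subsetP sHE; apply/forall_inP => f fH; apply/exists_inP.
have vbP b : ~~ bare H b -> vb b \in canonical_cover H.
  by move=> fb; apply/setUP; left; apply: imset_f.
case: (gadget_edgeP (sHE f fH)) => [[a [b def_f]]|[b fb]].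
  case: (boolP (bare H b)) => [bare_b|/vbP bC]; last first.
    by exists (vb b); rewrite // def_f set22.
  exists (va a); last by rewrite def_f set21.
  apply/setUP; right; apply: imset_f; apply/existsP; exists b.
  by rewrite bare_b -def_f.
exists (vb b); last by case/imsetP: fb => j _ ->; rewrite set22.
by apply: vbP; rewrite /bare -setI_eq0; apply/set0Pn; exists f; rewrite inE fb.
Qed.

(** A union bound: an A-vertex is charged once for each realized edge to a bare vertex, which makes
    the bound linear in events of known probability. *)
Lemma card_canonical_cover H :
  (#|canonical_cover H| <= \sum_b (~~ bare H b) +
     \sum_a \sum_b (bare H b && (eab a b \in H)))%N.
Proof.
apply: leq_trans (leq_card_setU _ _) _; apply: leq_add.
  apply: leq_trans (leq_imset_card _ _) _; rewrite -sum1_card big_mkcond /=.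
  by apply: leq_sum => b _; rewrite inE; case: bare.
apply: leq_trans (leq_imset_card _ _) _; rewrite -sum1_card big_mkcond /=.
apply: leq_sum => a _; rewrite inE; case: existsP => // -[b fb].
by rewrite (bigD1 b) //= fb.
Qed.

Lemma card_gvertex_set C : #|C| =
  (\sum_a (va a \in C) + \sum_b ((vb b \in C) + \sum_j (vl b j \in C)))%N.
Proof.
rewrite -sum1_card big_mkcond /= !big_sumType /= big_split /= addnA.
congr (_ + _ + _)%N; try by apply: eq_bigr => v _; rewrite /va /vb; case: ifP.
by rewrite pair_bigA /=; apply: eq_bigr => -[b j] _; rewrite /vl; case: ifP.
Qed.

(** Each of the [m] vertices of A lies on at most [max_degree Q] queried edges. *)
Lemma unqueried_count Q :
  (m * n <= \sum_b \sum_a (eab a b \notin Q) + m * max_degree Q)%N.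
Proof.
have -> : (m * n = \sum_(a : 'I_m) \sum_(b : 'I_n) 1)%N.
  by rewrite !sum_nat_const !card_ord muln1.
have -> : (m * max_degree Q = \sum_(a < m) max_degree Q)%N.
  by rewrite sum_nat_const card_ord.
rewrite [X in (_ <= X + _)%N]exchange_big -big_split /=; apply: leq_sum => a _.
have le_deg : (\sum_b (eab a b \in Q) <= max_degree Q)%N.
  apply: leq_trans (leq_bigmax (va a)); rewrite /degree.
  have -> : (\sum_b (eab a b \in Q)
      = #|[set eab a b | b in [pred b | eab a b \in Q]]|)%N.
    rewrite card_imset; last by move=> b b' /eab_inj[].
    rewrite -sum1_card [RHS]big_mkcond; apply: eq_bigr => b _.
    by rewrite inE; case: (_ \in Q).
  apply/subset_leq_card/subsetP => f /imsetP[b bQ ->]; rewrite !inE in bQ *.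
  by rewrite bQ eqxx.
apply: leq_trans (leq_add (leqnn _) le_deg); rewrite -big_split /=.
by apply: leq_sum => b _; case: (_ \in Q).
Qed.

End Gadget.

(** * Expected cost of the optimum and of the algorithm on the gadget *)

Section GadgetCost.
Variables (R : realType) (m n k : nat) (p : R).
Hypothesis p01 : 0 < p < 1.
Notation G := (gadget m n k).
Notation q := ((1 - p) ^+ k).
Implicit Types (H Q : {set {set G}}) (C : {set G}).

Lemma expect_bare b : Gp_expect p (fun H => (bare H b)%:R) = q.
Proof.
transitivity (Gp_expect p (fun H : {set {set G}} =>
    ((set0 \subset H) && [disjoint pend m k b & H])%:R)).
  by apply: eq_Gp_expect => H; rewrite sub0set.
rewrite Gp_expect_incl_excl ?sub0set ?pend_sub //; last first.
  by rewrite -setI_eq0 set0I.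
by rewrite cards0 card_pend mul1r.
Qed.

(** Distinct vertices have disjoint pendant sets, so being bare is pairwise independent. *)
Lemma expect_bare_pair b b' : b != b' ->
  Gp_expect p (fun H => (bare H b && bare H b')%:R) = q ^+ 2.
Proof.
move=> nbb'; have dbb' := pend_disjoint m k nbb'.
have card_bb' : #|pend m k b :|: pend m k b'| = (k + k)%N.
  by rewrite cardsU (disjoint_setI0 dbb') cards0 subn0 !card_pend.
transitivity (Gp_expect p (fun H : {set {set G}} =>
    ((set0 \subset H) && [disjoint pend m k b :|: pend m k b' & H])%:R)).
  by apply: eq_Gp_expect => H; rewrite sub0set /bare -!setI_eq0 setIUl setU_eq0.
rewrite Gp_expect_incl_excl ?sub0set ?subUset ?pend_sub //; last first.
  by rewrite -setI_eq0 set0I.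
by rewrite cards0 card_bb' mul1r exprD.
Qed.

Lemma expect_bare_edge a b :
  Gp_expect p (fun H => (bare H b && (eab k a b \in H))%:R) = p * q.
Proof.
transitivity (Gp_expect p (fun H : {set {set G}} =>
    (([set eab k a b] \subset H) && [disjoint pend m k b & H])%:R)).
  by apply: eq_Gp_expect => H; rewrite sub1set andbC.
rewrite Gp_expect_incl_excl ?sub1set ?eab_edge ?pend_sub //; last first.
  by rewrite disjoints1 eab_notin_pend.
by rewrite cards1 card_pend.
Qed.

Lemma expect_covered :
  Gp_expect p (fun H => \sum_(b : 'I_n) (~~ @bare m n k H b)%:R)
  = n%:R * (1 - q).
Proof.
rewrite Gp_expect_sum (eq_bigr (fun=> 1 - q)).
  by rewrite sumr_const card_ord mulr_natl.
move=> b _; apply/eqP; rewrite -subr_eq opprK -(expect_bare b).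
rewrite -Gp_expectD -[X in _ == X](Gp_expect_cst G p 1); apply/eqP.
by apply: eq_Gp_expect => H; case: bare; rewrite ?addr0 ?add0r.
Qed.

Lemma expect_nu_le :
  Gp_expect p (fun H => (nu H)%:R) <= n%:R * (1 - q) + m%:R * n%:R * (p * q).
Proof.
have -> : m%:R * n%:R * (p * q)
    = \sum_(a < m) \sum_(b < n) Gp_expect p
        (fun H : {set {set G}} => (bare H b && (eab k a b \in H))%:R).
  under eq_bigr => a _.
    under eq_bigr => b _ do rewrite expect_bare_edge.
    rewrite sumr_const card_ord; over.
  rewrite /= sumr_const card_ord -[RHS]mulr_natl -[X in _ = _ * X]mulr_natl.
  by rewrite -mulrA.
rewrite -expect_covered; under eq_bigr do rewrite -Gp_expect_sum.
rewrite -Gp_expect_sum -Gp_expectD; apply: ler_Gp_expect => // H sHE.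
under [X in _ + X]eq_bigr do rewrite -natr_sum.
rewrite -!natr_sum -natrD ler_nat.
exact: leq_trans (nu_le (canonical_coverP sHE)) (card_canonical_cover H).
Qed.

(* If [x] vertices of B are bare, an A-vertex covers at most [x] of the
   unqueried edges at bare vertices and a bare vertex at most [m] of them. When
   [x <= m] the loss in replacing [x] by [m] is nonnegative, and
   otherwise it is at most [m * (x - m) <= x ^+ 2 / 4]. *)
Lemma card_cover_ge H Q C :
  vertex_cover (H :|: (edges G :\: Q)) C ->
  m%:R * \sum_(b : 'I_n) (~~ bare H b)%:R
    + \sum_(b : 'I_n) (bare H b)%:R * \sum_(a : 'I_m) (eab k a b \notin Q)%:R
    - (\sum_(b : 'I_n) (bare H b)%:R) ^+ 2 / 4 <= m%:R * #|C|%:R :> R.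
Proof.
move=> /forall_inP covC.
pose x : R := \sum_(b : 'I_n) (bare H b)%:R.
pose alpha a : R := (va n k a \in C)%:R.
pose beta b : R := (vb m k b \in C)%:R.
pose y := \sum_a alpha a; pose z := \sum_b (bare H b)%:R * beta b.
(* A non-bare [b] has a realized pendant edge, so [C] contains [vb b] or one of the leaves at [b];
   no leaf is shared by two vertices of B. *)
have le_C : y + z + \sum_(b : 'I_n) (~~ bare H b)%:R <= #|C|%:R.
  rewrite card_gvertex_set natrD natr_sum -addrA lerD2l -big_split natr_sum.
  apply: ler_sum => b _ /=; case: (boolP (bare H b)) => /= [_|].
    by rewrite addr0 mul1r ler_nat leq_addr.
  rewrite /bare -setI_eq0 => /set0Pn[f /setIP[fb fH]].
  rewrite mul0r add0r ler_nat; have /imsetP[j _ def_f] := fb.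
  have /exists_inP[v vC vf] := covC f (subsetP (subsetUl _ _) f fH).
  move: vf vC; rewrite def_f => /set2P[]-> vC; last by rewrite vC.
  by rewrite (bigD1 j) //= vC addnA addnAC addn1.
(* At a bare [b], the unqueried edges covered from A number at most [y], and those covered by [vb b]
   at most [m]. *)
have le_e :
    \sum_(b : 'I_n) (bare H b)%:R * \sum_(a : 'I_m) (eab k a b \notin Q)%:R
    <= y * x + m%:R * z.
  rewrite mulrC mulr_suml mulr_sumr -big_split; apply: ler_sum => b _ /=.
  rewrite mulrCA -mulrDr ler_wpM2l ?ler0n //.
  rewrite mulr_natl -[m in beta b *+ m]card_ord -sumr_const -big_split.
  apply: ler_sum => a _ /=; case: (boolP (eab k a b \in Q)) => [_|abQ].
    by rewrite addr_ge0 ?ler0n.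
  have abE : eab k a b \in H :|: (edges G :\: Q).
    by rewrite inE [_ \in edges _ :\: _]inE abQ eab_edge orbT.
  have /exists_inP[v vC vab] := covC _ abE.
  rewrite -natrD ler_nat; move: vab vC => /set2P[]-> ->; first by [].
  by rewrite addn1.
have y_ge0 : 0 <= y by rewrite sumr_ge0 // => a _; rewrite ler0n.
have y_le : y <= m%:R.
  rewrite -[m in m%:R]card_ord -sumr_const; apply: ler_sum => a _.
  by rewrite lern1 leq_b1.
have xm : y * (x - m%:R) <= x ^+ 2 / 4.
  have [x_le|x_gt] := leP x m%:R.
    apply: (@le_trans _ _ 0); last by rewrite divr_ge0 ?sqr_ge0.
    by rewrite mulr_ge0_le0 // subr_le0.
  apply: (@le_trans _ _ (m%:R * (x - m%:R))).
    by rewrite ler_wpM2r // subr_ge0 ltW.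
  rewrite -subr_ge0 (_ : _ - _ = (x / 2 - m%:R) ^+ 2) ?sqr_ge0 //.
  by field.
have := ler_wpM2l (ler0n R m) le_C; rewrite -/x => le_mC.
by apply: le_trans le_mC; nra.
Qed.

(** Expanding the square, off-diagonal pairs contribute [q ^+ 2] each and diagonal ones [q], bounded
    by [q + q ^+ 2] to keep the sum uniform. *)
Lemma expect_bare_sqr_le :
  Gp_expect p (fun H => (\sum_(b : 'I_n) (@bare m n k H b)%:R) ^+ 2)
    <= n%:R * q + (n%:R * q) ^+ 2.
Proof.
have q_ge0 : 0 <= q by rewrite exprn_ge0 // subr_ge0 ltW // (andP p01).2.
have -> : n%:R * q + (n%:R * q) ^+ 2
    = \sum_(b : 'I_n) \sum_(b' : 'I_n) ((b == b')%:R * q + q ^+ 2).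
  under eq_bigr => b _.
    rewrite big_split -mulr_suml sumr_const card_ord /= (bigD1 b) //= eqxx.
    rewrite big1 => [|b' nb'b]; last by rewrite eq_sym (negPf nb'b).
    over.
  rewrite sumr_const card_ord -[RHS]mulr_natl.
  by rewrite -[X in _ = _ * (_ + X)]mulr_natl /=; ring.
rewrite (@eq_Gp_expect _ _ _ _ (fun H => \sum_(b : 'I_n) \sum_(b' : 'I_n)
    (bare H b && bare H b')%:R)); last first.
  move=> H; rewrite expr2 mulr_suml; apply: eq_bigr => b _.
  by rewrite mulr_sumr; apply: eq_bigr => b' _; rewrite -natrM mulnb.
rewrite Gp_expect_sum; apply: ler_sum => b _.
rewrite Gp_expect_sum; apply: ler_sum => b' _.
have [<-|nbb'] := eqVneq b b'; last by rewrite expect_bare_pair // mul0r add0r.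
rewrite (@eq_Gp_expect _ _ _ _ (fun H => (bare H b)%:R)) => [|H].
  by rewrite expect_bare mul1r lerDl sqr_ge0.
by rewrite andbb.
Qed.

(** The expectation of [card_cover_ge] for [Q := query w]. By non-adaptivity the number [r b] of
    unqueried edges at [b] does not depend on [H], so it factors out. *)
Lemma expect_result_ge (A : algorithm R G) (w : seed A) :
  covers_with_prob1 p A -> 0 < weight w ->
  m%:R * (n%:R * (1 - q)) + q * (m%:R * n%:R - m%:R * (max_degree (query w))%:R)
    - (n%:R * q + (n%:R * q) ^+ 2) / 4
  <= m%:R * Gp_expect p (fun H => #|result w H|%:R).
Proof.
move=> covA w_gt0.
have q_ge0 : 0 <= q by rewrite exprn_ge0 // subr_ge0 ltW // (andP p01).2.
pose r b : R := \sum_(a : 'I_m) (@eab m n k a b \notin query w)%:R.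
have sum_r : m%:R * n%:R - m%:R * (max_degree (query w))%:R <= \sum_b r b.
  rewrite lerBlDr -!natrM; under eq_bigr do rewrite /r -natr_sum.
  by rewrite -natr_sum -natrD ler_nat unqueried_count.
rewrite -Gp_expectZ.
pose X H : R := m%:R * \sum_(b : 'I_n) (~~ bare H b)%:R
    + \sum_(b : 'I_n) (bare H b)%:R * r b
    + (- 4^-1) * (\sum_(b : 'I_n) (bare H b)%:R) ^+ 2.
apply: (@le_trans _ _ (Gp_expect p X)); last first.
  apply: ler_Gp_expect => // H sHE; rewrite /X mulNr [4^-1 * _]mulrC.
  exact: card_cover_ge (result_covers_unqueried p01 covA w_gt0 sHE).
rewrite /X !Gp_expectD !Gp_expectZ expect_covered Gp_expect_sum.
have -> : \sum_(b < n) Gp_expect p (fun H => (bare H b)%:R * r b)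
    = q * \sum_b r b.
  rewrite mulr_sumr; apply: eq_bigr => b _.
  rewrite -(expect_bare b) mulrC -Gp_expectZ.
  by apply: eq_Gp_expect => H; rewrite mulrC.
have := ler_wpM2l q_ge0 sum_r; have := expect_bare_sqr_le.
lra.
Qed.

End GadgetCost.

(** * Choice of parameters and the final comparison *)

Lemma exists_expr_between (R : realType) (x t : R) :
  0 < x < 1 -> 0 < t <= 1 -> exists k, t <= x ^+ k /\ x ^+ k.+1 < t.
Proof.
move=> /andP[x_gt0 x_lt1] /andP[t_gt0 t_le1].
have ex_k : exists k, x ^+ k < t.
  pose y := x^-1 - 1; have y_gt0 : 0 < y by rewrite subr_gt0 invf_gt1.
  (* Bernoulli's inequality for [x^-1 = 1 + y]: the powers of [x^-1] exceed [t^-1] once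
     [i > 1 / (t * y)]. *)
  have bern i : 1 + y *+ i <= x^-1 ^+ i.
    elim: i => [|i IHi]; first by rewrite mulr0n addr0 expr0.
    have xV_ge0 : 0 <= x^-1 by rewrite invr_ge0 ltW.
    rewrite exprS; apply: le_trans (ler_wpM2l xV_ge0 IHi).
    rewrite (_ : x^-1 = 1 + y); last by rewrite /y; ring.
    have : 0 <= y * (y *+ i) by rewrite mulr_ge0 ?mulrn_wge0 ?ltW.
    by rewrite mulrS; lra.
  have tV_ge0 : 0 <= (t * y)^-1 by rewrite invr_ge0 mulr_ge0 ?ltW.
  exists (Num.bound (t * y)^-1); set i := Num.bound _.
  have i_gt : (t * y)^-1 < i%:R := archi_boundP tV_ge0.
  rewrite -[x]invrK exprVn -[t]invrK ltf_pV2 ?posrE ?invr_gt0 //; last first.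
    by rewrite exprn_gt0 ?invr_gt0.
  apply: lt_le_trans (bern i); apply: ltr_pwDl => //.
  by rewrite -mulr_natl -ler_pdivrMr // -invfM ltW.
(* The least exponent is a successor because [x ^+ 0 = 1] is at least [t]. *)
have [[|k] x_lt min_k] := ex_minnP ex_k.
  by move: x_lt; rewrite expr0 ltNge t_le1.
exists k; split=> //; rewrite leNgt; apply/negP => /min_k.
by rewrite ltnn.
Qed.

(** After division by [M * N], the left side is at most [1 - 12 q / 32], while the right side is at
    least [1 - q / 16 - q / 32 - q / 8 = 1 - 7 q / 32]. *)
Lemma gadget_cost_gap (R : realFieldType) (M N p q eps D : R) :
  0 < p <= 1 / 16 -> 0 < eps -> 16 * eps <= q ->
  1 / 2 <= M * p <= 1 / 2 + p -> 1 <= N -> D <= N / 16 -> N * q * p <= 1 / 4 ->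
  M * ((1 + eps) * (N * (1 - q) + M * N * (p * q)))
    < M * (N * (1 - q)) + q * (M * N - M * D) - (N * q + (N * q) ^+ 2) / 4.
Proof.
move=> /andP[p_gt0 p_le] e_gt0 q_ge /andP[Mp_ge Mp_le] N_ge1 D_le Nq_le.
have q_gt0 : 0 < q by lra.
have M_ge : 8 <= M by nra.
have M_gt0 : 0 < M by lra.
have Nq_le_M : N * q <= M / 2 by rewrite -(ler_pM2r p_gt0); lra.
have N_gt0 : 0 < N by lra.
have MN_gt0 : 0 < M * N by rewrite mulr_gt0.
have qD : q * (M * D) <= M * N * (q / 16).
  have := ler_wpM2l (ltW (mulr_gt0 q_gt0 M_gt0)) D_le; lra.
have qN : N * q / 4 <= M * N * (q / 32).
  have := ler_wpM2r (ltW (mulr_gt0 N_gt0 q_gt0)) M_ge; lra.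
have qN2 : (N * q) ^+ 2 / 4 <= M * N * (q / 8).
  have := ler_wpM2r (ltW (mulr_gt0 N_gt0 q_gt0)) Nq_le_M; lra.
(* Here [M * p <= 9 / 16] and [eps <= q / 16], and [1 - 7 / 16 q + q / 16 = 1 - 3 / 8 q]. *)
have cost : (1 + eps) * (1 - q * (1 - M * p)) <= 1 - q * (3 / 8).
  have : q * (M * p) <= q * (9 / 16) by rewrite ler_wpM2l ?(ltW q_gt0) //; lra.
  have : 0 <= q * (1 - M * p) by rewrite mulr_ge0 ?(ltW q_gt0) //; lra.
  nra.
have := ler_wpM2l (ltW MN_gt0) cost.
have := mulr_gt0 MN_gt0 q_gt0.
lra.
Qed.

Theorem theorem7p4 (R : realType) :
  exists p0 eps0 c : R,
    [/\ 0 < p0 < 1, 0 < eps0 < 1, 0 < c &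
      forall p eps : R, 0 < p <= p0 -> 0 < eps <= eps0 ->
        exists G : sgraph, bipartite G /\
          forall A : algorithm R G,
            covers_with_prob1 p A -> approximates p eps A ->
            exists w : seed A,
              0 < weight w /\ c / (eps * p) <= (max_degree (query w))%:R].
Proof.
(* [eps <= 1 / 16] makes the target [16 * eps] for [q] at most 1. The factor 4096 is 128 * 32: the
   degree threshold is [s / 32], at most [n / 16]. *)
exists (1 / 16), (1 / 16), (1 / 4096).
split; [lra | lra | lra | move=> p eps /andP[p_gt0 p_le] /andP[e_gt0 e_le]].
have p01 : 0 < p < 1 by lra.
have ep_gt0 : 0 < eps * p by rewrite mulr_gt0.
have [k [q_ge qS]] : exists k,
    16 * eps <= (1 - p) ^+ k /\ (1 - p) ^+ k.+1 < 16 * eps.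
  by apply: exists_expr_between; lra.
set q := (1 - p) ^+ k in q_ge.
(* One more factor [1 - p >= 1 / 2] brings [q] below [16 * eps]. *)
have q_le : q <= 32 * eps.
  by move: qS; rewrite exprS -/q; nra.
pose s : R := 1 / (128 * (eps * p)).
have s_ge : 1 <= s.
  by rewrite /s ler_pdivlMr ?mulr_gt0 //; nra.
pose t : R := (2 * p)^-1.
have t_gt0 : 0 < t by rewrite invr_gt0 mulr_gt0.
have tp : t * p = 1 / 2 by rewrite /t; field; rewrite gt_eqF.
(* Rounding [s >= 1] down loses at most a factor 2; truncating [t + 1] puts [m] between [t] and
   [t + 1], so that [m * p >= 1 / 2]. *)
pose n := Num.truncn s; pose m := Num.truncn (t + 1).
have /andP[n_le n_gt] : n%:R <= s < n.+1%:R by rewrite truncn_itv //; lra.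
have /andP[m_le m_gt] : m%:R <= t + 1 < m.+1%:R by rewrite truncn_itv //; lra.
have n_ge1 : 1 <= n%:R :> R by rewrite ler1n truncn_gt0.
have n_ge : s / 2 <= n%:R by have := @natr1 R n; lra.
have mp_le : m%:R * p <= 1 / 2 + p.
  by have := ler_wpM2r (ltW p_gt0) m_le; rewrite mulrDl tp; lra.
have mp_ge : 1 / 2 <= m%:R * p.
  by rewrite -tp ler_wpM2r ?(ltW p_gt0) //; have := @natr1 R m; lra.
exists (gadget m n k); split; first exact: gadget_bipartite.
move=> A covA apxA; pose D : R := 1 / 4096 / (eps * p).
have [/existsP[w /andP[w_gt0 w_deg]]|] :=
    boolP [exists w : seed A,
      (0 < weight w) && (D <= (max_degree (query w))%:R)].
  by exists w.
rewrite negb_exists => /forallP small; exfalso.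
have q_gt0 : 0 < q by lra.
have m_gt0 : 0 < m%:R :> R by nra.
pose L : R := m%:R * (n%:R * (1 - q)) + q * (m%:R * n%:R - m%:R * D)
    - (n%:R * q + (n%:R * q) ^+ 2) / 4.
(* Averaging over the seeds: [L] bounds the cost for each seed of positive weight, as its degree is
   below [D], and the other seeds contribute nothing. *)
have L_le : L <= m%:R * alg_expect p (fun (w : seed A) H => #|result w H|%:R).
  rewrite -[L]mul1r -[X in X * L](weight_sum1 A) mulr_suml mulr_sumr.
  apply: ler_sum => w _.
  have [w0|w_neq0] := eqVneq (weight w) 0; first by rewrite w0 !mul0r mulr0.
  have w_gt0 : 0 < weight w by rewrite lt0r w_neq0 weight_ge0.
  rewrite mulrCA ler_wpM2l ?weight_ge0 //.
  apply: le_trans (expect_result_ge p01 covA w_gt0).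
  have := small w; rewrite w_gt0 /= -ltNge => /ltW deg_le.
  rewrite lerD2r lerD2l (ler_wpM2l (ltW q_gt0)) // lerD2l lerN2.
  by rewrite ler_wpM2l // ltW.
have U_ge := expect_nu_le m n k p01.
have e1_gt0 : 0 < 1 + eps by lra.
have : L <= m%:R * ((1 + eps) * (n%:R * (1 - q) + m%:R * n%:R * (p * q))).
  apply: le_trans L_le _; rewrite ler_wpM2l ?(ltW m_gt0) //.
  by apply: le_trans apxA _; rewrite ler_wpM2l // ltW.
apply/negP; rewrite -ltNge; apply: gadget_cost_gap => //.
- by rewrite p_gt0.
- by rewrite mp_ge.
- rewrite (_ : D = s / 32); first lra.
  by rewrite /D /s; field; rewrite !gt_eqF.
- rewrite (_ : 1 / 4 = s * (32 * eps) * p).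
    by rewrite ler_wpM2r ?ler_pM ?(ltW p_gt0) // ?ler0n // ltW.
  by rewrite /s; field; rewrite !gt_eqF.
Qed.
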